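(* Let $K\subseteq\mathbf{R}^n$ be a nonempty closed set and let $f=(f_1,\dots,f_s):\mathbf{R}^n\to\mathbf{R}^s$ be a vector polynomial with $\deg f_i=d_i\ge 1$ for $i=1,\dots,s$. If $\mathrm{PVOP}(K,f)$ is weakly regular and $f$ is bounded from below on $K$, then $SOL^{s}(K,f)$ is nonempty.
   Context: $\mathbf{R}^s_+$ is the nonnegative orthant. For a nonempty closed set $C\subseteq\mathbf{R}^n$ and a vector polynomial $h:\mathbf{R}^n\to\mathbf{R}^s$, $\mathrm{PVOP}(C,h)$ is the problem of minimizing $h$ over $C$ with respect to $\mathbf{R}^s_+$, and $SOL^{s}(C,h)$ (Pareto efficient solutions) is the set of $x^*\in C$ such that $h(x)-h(x^* )\notin-\mathbf{R}^s_+\setminus\{0\}$ for all $x\in C$. The asymptotic cone of $K$ is $K_\infty=\{v\in\mathbf{R}^n:\text{ there exist } t_k\to+\infty \text{ and } x_k\in K \text{ with } x_k/t_k\to v\}$. For a vector polynomial $p=(p_1,\dots,p_s)$ with $\deg p_i=d_i$, $p^\infty=(p_1^\infty,\dots,p_s^\infty)$ where $p_i^\infty(x)=\lim_{\lambda\to+\infty}p_i(\lambda x)/\lambda^{d_i}$. $\mathrm{PVOP}(K,f)$ is weakly regular if $SOL^{s}(K_\infty,f^\infty)$ is bounded (the empty set counts as bounded). $f$ is bounded from below on $K$ if there is $r\in\mathbf{R}^s$ with $f(x)\in r+\mathbf{R}^s_+$ for all $x\in K$. *)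

(* Defs.v *)
(* MathComp-Analysis: the real numbers are an arbitrary [R : realType]
   and R^n is ['rV[R]_n]. *)
From HB Require Import structures.
From mathcomp Require Import all_boot all_order all_algebra.
From mathcomp Require Import all_classical all_reals all_analysis.
(* Only the canonical structures and coercions of [mpoly] are imported: its
   notations clash with those of the analysis library. *)
From mathcomp Require Import (canonicals, coercions) mpoly.

Set Implicit Arguments.
Unset Strict Implicit.
Unset Printing Implicit Defensive.

Import Order.TTheory GRing.Theory Num.Theory.
Import numFieldNormedType.Exports.

Local Open Scope classical_set_scope.
Local Open Scope ring_scope.

Definition vpoly (R : realType) (n s : nat) : Type :=
  'I_s -> mpoly.mpoly n R.

(* [msize] is the total degree plus one, and [msize 0 = 0]; hence both the
   constants and the zero polynomial get degree 0 here. *)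
Definition mpdeg (R : realType) (n : nat) (p : mpoly.mpoly n R) : nat :=
  (mpoly.msize p).-1.

Definition mpeval (R : realType) (n : nat) (p : mpoly.mpoly n R)
    (x : 'rV[R]_n) : R :=
  mpoly.meval (fun j : 'I_n => x ord0 j) p.

Definition vpeval (R : realType) (n s : nat) (f : vpoly R n s)
    (x : 'rV[R]_n) : 'rV[R]_s :=
  \row_(i < s) mpeval (f i) x.

Definition lead_form (R : realType) (n : nat) (p : mpoly.mpoly n R)
    (x : 'rV[R]_n) : R :=
  lim ((fun lambda : R => mpeval p (lambda *: x) / lambda ^+ mpdeg p) @ +oo).

Definition vlead_form (R : realType) (n s : nat) (f : vpoly R n s)
    (x : 'rV[R]_n) : 'rV[R]_s :=
  \row_(i < s) lead_form (f i) x.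

Definition nonneg_orthant (R : realType) (s : nat) : set 'rV[R]_s :=
  [set y | forall i : 'I_s, 0 <= y ord0 i].

(* The objective is an arbitrary map, so that the definition applies both to
   [vpeval f] and to [vlead_form f]. *)
Definition pareto_sol (R : realType) (n s : nat) (C : set 'rV[R]_n)
    (h : 'rV[R]_n -> 'rV[R]_s) : set 'rV[R]_n :=
  [set xs | C xs /\ forall x, C x ->
     ~ ([set - y | y in @nonneg_orthant R s] `\ 0) (h x - h xs)].

Definition asymptotic_cone (R : realType) (n : nat) (K : set 'rV[R]_n) :
    set 'rV[R]_n :=
  [set v | exists (t : nat -> R) (x : nat -> 'rV[R]_n),
     [/\ t @ \oo --> +oo,
         forall k, K (x k) &
         (fun k => (t k)^-1 *: x k) @ \oo --> v]].

Definition weakly_regular (R : realType) (n s : nat) (K : set 'rV[R]_n)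
    (f : vpoly R n s) : Prop :=
  bounded_set (pareto_sol (asymptotic_cone K) (vlead_form f)).

Definition bounded_below_on (R : realType) (n s : nat) (K : set 'rV[R]_n)
    (f : vpoly R n s) : Prop :=
  exists r : 'rV[R]_s, forall x, K x ->
    [set r + y | y in @nonneg_orthant R s] (vpeval f x).

(* Main.v *)
(* Since f is bounded below on K and every degree is positive, all leading forms
   are nonnegative on the asymptotic cone of K, so every direction of that cone
   where they all vanish is efficient; these directions form a cone, so weak
   regularity leaves only 0.  If a sublevel set {x in K | sum_i f_i x <= c} were
   unbounded, it would have a nonzero asymptotic direction, along which each f_i
   stays bounded and hence each leading form vanishes, a contradiction.  So the
   sublevel sets are compact, sum_i f_i has a minimizer on K, and this minimizer
   is efficient. *)
Require Import Defs.
From HB Require Import structures.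
From mathcomp Require Import all_boot all_order all_algebra.
From mathcomp Require Import all_classical all_reals all_analysis.
From mathcomp Require Import (canonicals, coercions) mpoly.

Import Order.TTheory GRing.Theory Num.Theory.
Import numFieldNormedType.Exports.

Local Open Scope classical_set_scope.
Local Open Scope ring_scope.

(* A polynomial in (e, x), so both [mpeval p] (at e = 1) and the leading form
   (at e = 0) are read off from its joint continuity. *)
Definition homogenization {R : realType} {n : nat} (p : mpoly.mpoly n R)
    (e : R) (x : 'rV[R]_n) : R :=
  \sum_(m <- mpoly.msupp p)
    mpoly.mcoeff m p * (e ^+ (mpdeg p - mpoly.mdeg m) *
                        \prod_(i < n) x ord0 i ^+ m i).

Lemma homogenization1 {R : realType} {n : nat} (p : mpoly.mpoly n R)
    (x : 'rV[R]_n) : homogenization p 1 x = mpeval p x.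
Proof.
rewrite /mpeval mpoly.mevalE; apply: eq_bigr => m _.
by rewrite expr1n mul1r.
Qed.

(** A monomial [m] picks up [t ^+ mdeg m], and dividing by [t ^+ mpdeg p] leaves a power of [t^-1]
    with exponent [mpdeg p - mdeg m]; this natural subtraction is never truncated on the support. *)
Lemma mpevalZ {R : realType} {n : nat} (p : mpoly.mpoly n R) (t : R)
    (x : 'rV[R]_n) : t != 0 ->
  mpeval p (t *: x) / t ^+ mpdeg p = homogenization p t^-1 x.
Proof.
move=> t0; rewrite /mpeval mpoly.mevalE /homogenization mulr_suml [LHS]big_seq [RHS]big_seq.
apply: eq_bigr => m m_supp; rewrite -mulrA; congr (_ * _).
have le_deg : (mpoly.mdeg m <= mpdeg p)%N.
  by have := mpoly.msize_mdeg_lt m_supp; rewrite /mpdeg; case: (mpoly.msize p).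
under eq_bigr do rewrite mxE exprMn.
rewrite big_split /= prodrXr -mpoly.mdegE mulrAC; congr (_ * _).
by rewrite exprVn -[in LHS](subnK le_deg) exprD invfM mulrCA divff ?mulr1 ?expf_neq0.
Qed.

Lemma cvg_homogenization {R : realType} {n : nat} (p : mpoly.mpoly n R)
    {T : Type} {F : set_system T} {FF : Filter F} {e : T -> R}
    {y : T -> 'rV[R]_n} {a : R} {v : 'rV[R]_n} :
  e @ F --> a -> y @ F --> v ->
  homogenization p (e x) (y x) @[x --> F] --> homogenization p a v.
Proof.
move=> ea yv; apply: cvg_big => [|m _]; first exact: add_continuous.
apply: cvgM; first exact: cvg_cst.
apply: cvgM; first exact: (continuous_cvg _ (@exprn_continuous R _ a) ea).
apply: cvg_big => [|i _]; first exact: mul_continuous.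
apply: (continuous_cvg _ (@exprn_continuous R _ _)).
exact: (continuous_cvg _ (@coord_continuous R _ _ _ _ v) yv).
Qed.

Lemma mpeval_continuous {R : realType} {n : nat} (p : mpoly.mpoly n R) :
  continuous (mpeval p).
Proof.
have -> : mpeval p = homogenization p 1.
  by apply/funext => x; rewrite homogenization1.
move=> v.
by apply: (cvg_homogenization p (F := nbhs v) (e := cst 1) (y := id));
  [exact: cvg_cst|exact: cvg_id].
Qed.

(** The direction [y x] moves along with [t x], so a limit along a fixed ray would not suffice;
    joint continuity of the homogenization at [(0, v)] handles both at once. *)
Lemma cvg_lead_form_homogenization {R : realType} {n : nat}
    (p : mpoly.mpoly n R) {T : Type} {F : set_system T} {FF : Filter F}
    {t : T -> R} {y : T -> 'rV[R]_n} {v : 'rV[R]_n} :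
  t @ F --> +oo -> y @ F --> v ->
  mpeval p (t x *: y x) / t x ^+ mpdeg p @[x --> F] -->
    homogenization p 0 v.
Proof.
move=> ty yv.
have t_gt0 : \forall x \near F, 0 < t x by exact: cvgry_gt.
have t_inv : (t x)^-1 @[x --> F] --> 0 by apply/gtr0_cvgV0.
apply: cvg_trans (cvg_homogenization p t_inv yv).
apply: near_eq_cvg; near=> x; rewrite mpevalZ// gt_eqF//.
by near: x.
Unshelve. all: by end_near. Qed.

Lemma cvg_lead_form {R : realType} {n : nat} (p : mpoly.mpoly n R)
    {T : Type} {F : set_system T} {FF : Filter F}
    {t : T -> R} {y : T -> 'rV[R]_n} {v : 'rV[R]_n} :
  t @ F --> +oo -> y @ F --> v ->
  mpeval p (t x *: y x) / t x ^+ mpdeg p @[x --> F] --> lead_form p v.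
Proof.
move=> ty yv; rewrite /lead_form.
(* The fixed direction [v] shows that the limit defining [lead_form] exists and equals
   [homogenization p 0 v]. *)
rewrite (cvg_lim _ (cvg_lead_form_homogenization p
  (t := id) (y := cst v) (v := v) _ _)) //.
- exact: cvg_lead_form_homogenization.
- exact: cvg_cst.
Qed.

(** The same points serve, with scales [t k / c]. *)
Lemma asymptotic_coneZ {R : realType} {n : nat} {K : set 'rV[R]_n} {c : R}
    {v : 'rV[R]_n} :
  0 < c -> asymptotic_cone K v -> asymptotic_cone K (c *: v).
Proof.
move=> c0 [t [x [ty Kx xv]]]; exists (fun k => t k / c), x; split => //.
  apply/cvgryPge => A; near=> k; rewrite ler_pdivlMr//.
  by near: k; exact: cvgry_ge.
under eq_cvg do rewrite invfM invrK mulrC -scalerA.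
exact: cvgZl_tmp.
Unshelve. all: by end_near. Qed.

Lemma sub_asymptotic_cone {R : realType} {n : nat} {K S : set 'rV[R]_n} :
  S `<=` K -> asymptotic_cone S `<=` asymptotic_cone K.
Proof. by move=> SK v [t [x [ty Sx xv]]]; exists t, x; split=> // k; exact/SK. Qed.

(** Points of [S] escaping to infinity, once normalized, cluster on the compact unit sphere; their
    norms serve as the scales. *)
Lemma unbounded_asymptotic_direction {R : realType} {n : nat}
    (S : set 'rV[R]_n) :
  ~ bounded_set S -> exists2 v, v != 0 & asymptotic_cone S v.
Proof.
move=> Sunb.
have far (k : nat) : exists x, S x /\ k%:R < `|x|.
  apply: contrapT => /forallNP near_all; apply: Sunb.
  exists k%:R; split; first exact: num_real.
  move=> M kM x Sx; apply: le_trans (ltW kM); rewrite leNgt; apply/negP => kx.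
  exact: (near_all x).
have [x Sx] := choice far.
pose u k := `|x k|^-1 *: x k.
have x_gt0 k : 0 < `|x k| by apply: le_lt_trans (Sx k).2.
have norm_u k : `|u k| = 1.
  by rewrite normrZ ger0_norm ?invr_ge0// mulVf// gt_eqF.
have sphere_compact : compact [set y : 'rV[R]_n | `|y| = 1].
  apply: bounded_closed_compact.
    by exists 1; split=> [|M M1 y /= ->]; [exact: num_real|exact: ltW].
  apply: (preimage_closed (f := fun y : 'rV[R]_n => `|y|) _ (@closed_eq R 1)).
  by move=> y _; exact: norm_continuous.
have [v [v1 uv]] : [set y : 'rV[R]_n | `|y| = 1] `&` cluster (u @ \oo) !=set0.
  by apply: sphere_compact; exists 0%N => // k _; exact: norm_u.
(* Indices [phi k >= k] need not increase strictly: they already force the norms of [x (phi k)]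
   above [k]. *)
have close (k : nat) : exists j, (k <= j)%N /\ `|v - u j| < harmonic k.
  have [_ [[j kj <-] uj]] : [set u j | j in [set j | (k <= j)%N]] `&`
      ball v (harmonic k) !=set0.
    apply: uv; last by apply: nbhsx_ballx; rewrite /= invr_gt0 ltr0n.
    by exists k => // j kj; exists j.
  by exists j; split => //; move: uj; rewrite -ball_normE.
have [phi phiP] := choice close.
exists v; first by rewrite -normr_eq0 v1 oner_neq0.
exists (fun k => `|x (phi k)|), (x \o phi); split.
- apply/cvgryPge => A; near=> k; apply: (@le_trans _ _ k%:R).
    by near: k; exact: (cvgry_ge (@cvgr_idn R)).
  by apply: le_trans (ltW (Sx (phi k)).2); rewrite ler_nat (phiP k).1.
- by move=> k; exact: (Sx (phi k)).1.
- apply/cvgrPdist_lt => e e0; near=> k; apply: lt_trans (phiP k).2 _.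
  by near: k; exact: (cvgr_lt 0 cvg_harmonic).
Unshelve. all: by end_near. Qed.

Lemma cvg_div_expry {R : realType} {T : Type} {F : set_system T}
    {FF : Filter F} {t : T -> R} (c : R) {d : nat} :
  (0 < d)%N -> t @ F --> +oo -> c / t x ^+ d @[x --> F] --> 0.
Proof.
move=> d_gt0 ty.
have t_inv : (t x)^-1 @[x --> F] --> 0.
  by apply/gtr0_cvgV0 => //; exact: cvgry_gt.
under eq_cvg do rewrite -exprVn.
have := @cvgMl_tmp _ _ _ _ _ c _ (continuous_cvg _ (@exprn_continuous R d 0) t_inv).
by rewrite expr0n gtn_eqF// mulr0; apply.
Qed.

Lemma cvg_lead_form_asymptotic {R : realType} {n : nat} (p : mpoly.mpoly n R)
    {t : nat -> R} {x : nat -> 'rV[R]_n} {v : 'rV[R]_n} :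
  t @ \oo --> +oo -> (t k)^-1 *: x k @[k --> \oo] --> v ->
  mpeval p (x k) / t k ^+ mpdeg p @[k --> \oo] --> lead_form p v.
Proof.
move=> ty xv; apply: cvg_trans (cvg_lead_form p ty xv).
apply: near_eq_cvg; near=> k; rewrite scalerA divff ?scale1r// gt_eqF//.
by near: k; exact: cvgry_gt.
Unshelve. all: by end_near. Qed.

(** As the degree is positive, the constant bound [c] vanishes after division by
    [t k ^+ mpdeg p]. *)
Lemma lead_form_ge0 {R : realType} {n : nat} (p : mpoly.mpoly n R)
    {S : set 'rV[R]_n} {c : R} {v : 'rV[R]_n} :
  (0 < mpdeg p)%N -> (forall x, S x -> c <= mpeval p x) ->
  asymptotic_cone S v -> 0 <= lead_form p v.
Proof.
move=> d_gt0 pS [t [x [ty Sx xv]]].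
have := ler_cvg_to (cvg_div_expry c d_gt0 ty)
  (cvg_lead_form_asymptotic p ty xv); apply.
near=> k; rewrite ler_wpM2r ?pS// invr_ge0 exprn_ge0// ltW//.
by near: k; exact: cvgry_gt.
Unshelve. all: by end_near. Qed.

Lemma lead_form_le0 {R : realType} {n : nat} (p : mpoly.mpoly n R)
    {S : set 'rV[R]_n} {c : R} {v : 'rV[R]_n} :
  (0 < mpdeg p)%N -> (forall x, S x -> mpeval p x <= c) ->
  asymptotic_cone S v -> lead_form p v <= 0.
Proof.
move=> d_gt0 pS [t [x [ty Sx xv]]].
have := ler_cvg_to (cvg_lead_form_asymptotic p ty xv)
  (cvg_div_expry c d_gt0 ty); apply.
near=> k; rewrite ler_wpM2r ?pS// invr_ge0 exprn_ge0// ltW//.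
by near: k; exact: cvgry_gt.
Unshelve. all: by end_near. Qed.

Lemma pareto_sol_zero {R : realType} {n s : nat} (C : set 'rV[R]_n)
    (h : 'rV[R]_n -> 'rV[R]_s) (xs : 'rV[R]_n) :
  C xs -> h xs = 0 -> (forall x, C x -> nonneg_orthant (h x)) ->
  pareto_sol C h xs.
Proof.
move=> Cxs h0 h_ge0; split => // x /h_ge0 hx; rewrite h0 subr0.
move=> [[y y_ge0 yhx]]; apply; apply/rowP => i; rewrite mxE.
apply/eqP; rewrite eq_le hx andbT.
by rewrite -yhx mxE oppr_le0.
Qed.

(** If [x] dominated [xs], the gain [y = h xs - h x] would have nonnegative entries and, by
    minimality, a sum at most 0, hence be zero. *)
Lemma pareto_sol_sum_min {R : realType} {n s : nat} (C : set 'rV[R]_n)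
    (h : 'rV[R]_n -> 'rV[R]_s) (xs : 'rV[R]_n) :
  C xs -> (forall x, C x -> \sum_i h xs ord0 i <= \sum_i h x ord0 i) ->
  pareto_sol C h xs.
Proof.
move=> Cxs xs_min; split => // x Cx [[y y_ge0 yh]]; apply; rewrite /= -yh.
have sum_y : \sum_i y ord0 i = 0.
  apply/eqP; rewrite eq_le sumr_ge0 ?andbT//.
  have -> : \sum_i y ord0 i = \sum_i h xs ord0 i - \sum_i h x ord0 i.
    rewrite -sumrB; apply: eq_bigr => i _.
    have /rowP/(_ i) := yh; rewrite !mxE => /eqP.
    by rewrite eqr_oppLR opprB => /eqP.
  by rewrite subr_le0 xs_min.
apply/rowP => i; rewrite !mxE; apply/eqP; rewrite oppr_eq0; apply/eqP.
exact: (psumr_eq0P _ sum_y).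
Qed.

Lemma sublevel_sum_bounded {R : realType} {n s : nat} (K : set 'rV[R]_n)
    (f : vpoly R n s) (c : R)
    (f_deg : forall i : 'I_s, (1 <= mpdeg (f i))%N)
    (f_wreg : weakly_regular K f) (f_bounded_below : bounded_below_on K f) :
  bounded_set [set x | K x /\ \sum_i mpeval (f i) x <= c].
Proof.
have [r Kr] := f_bounded_below.
have f_ge i x : K x -> r ord0 i <= mpeval (f i) x.
  move=> /Kr [y y_ge0 /rowP/(_ i)]; rewrite !mxE => <-.
  by rewrite lerDl; exact: y_ge0.
apply: contrapT => /unbounded_asymptotic_direction [v v0 Sv].
set S := [set x | _] in Sv.
have SK : S `<=` K by move=> x [].
(* The bound on the sum, minus the lower bounds of the other components, bounds each component
   above. *)
have f_le i x : S x -> mpeval (f i) x <= c - \sum_(j | j != i) r ord0 j.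
  move=> [Kx]; rewrite (bigD1 i)//= lerBrDr; apply: le_trans.
  by rewrite lerD2l ler_sum// => j _; exact: f_ge.
have ray l : 0 < l -> pareto_sol (asymptotic_cone K) (vlead_form f) (l *: v).
  move=> l0; have Slv := asymptotic_coneZ l0 Sv.
  apply: pareto_sol_zero.
  - exact: sub_asymptotic_cone Slv.
  - apply/rowP => i; rewrite !mxE; apply/eqP; rewrite eq_le.
    rewrite (lead_form_le0 _ (f_deg i) (f_le i) Slv).
    apply: (lead_form_ge0 _ (f_deg i) (f_ge i)).
    exact: (sub_asymptotic_cone SK _ Slv).
  - move=> w Kw i; rewrite mxE.
    exact: (lead_form_ge0 _ (f_deg i) (f_ge i) Kw).
have [M [_ Mbound]] := f_wreg.
have v_gt0 : 0 < `|v| by rewrite normr_gt0.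
(* [B] is above [M] and positive even if [M] is negative; scaling [v] to norm [B + 1] then violates
   the bound [B]. *)
pose B := `|M| + 1.
have B_gt0 : 0 < B by rewrite ltr_pwDr.
have MB : M < B by rewrite ltr_pwDr// ler_norm.
have lv_gt0 : 0 < (B + 1) / `|v| by rewrite divr_gt0// addr_gt0.
have /= := Mbound B MB _ (ray _ lv_gt0).
by rewrite normrZ gtr0_norm// mulfVK ?gt_eqF// gerDl ler10.
Qed.

Theorem corollary5p1 (R : realType) (n s : nat) (K : set 'rV[R]_n)
    (f : vpoly R n s)
    (K_nonempty : K !=set0) (K_closed : closed K)
    (f_deg : forall i : 'I_s, (1 <= mpdeg (f i))%N)
    (f_wreg : weakly_regular K f)
    (f_bounded_below : bounded_below_on K f) :
  pareto_sol K (vpeval f) !=set0.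
Proof.
have [x0 Kx0] := K_nonempty.
pose g x := \sum_i mpeval (f i) x.
have g_cont : continuous g.
  move=> x; apply: (@cvg_big _ _ _ _ _ _ _ (nbhs x)) => [|i _].
    exact: add_continuous.
  exact: mpeval_continuous.
pose S := [set x | K x /\ g x <= g x0].
have S_compact : compact S.
  apply: bounded_closed_compact; first exact: sublevel_sum_bounded.
  apply: closedI => //.
  apply: (preimage_closed (f := g) _ (@closed_le R (g x0))) => x _.
  exact: g_cont.
have [|xs /set_mem[Kxs xs_le] xs_min] :=
  EVT_min_rV _ S_compact (continuous_subspaceT g_cont).
  by exists x0.
exists xs; apply: pareto_sol_sum_min => // x Kx.
under eq_bigr do rewrite mxE; under [leRHS]eq_bigr do rewrite mxE.
(* Outside [S] the value exceeds [g x0], which is already at least [g xs]. *)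
have [gx|/ltW gx] := leP (g x) (g x0); last exact: le_trans xs_le gx.
by apply: xs_min; apply/mem_set.
Qed.
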